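(* Let $q$ be a prime power, let $m\ge 1$ and $t$ be integers with $t+1\mid m$, and let $H(x)\in\mathbb F_q[x]$ be a monic irreducible polynomial of degree $t+1$. Let $L=\{\alpha_1,\ldots,\alpha_n\}\subseteq\mathbb F_{q^m}$ be a set of $n$ distinct elements containing all roots of $H(x)$, and let $i_1,\ldots,i_{t+1}\in\{1,\ldots,n\}$ be the pairwise distinct indices such that $\alpha_{i_1},\ldots,\alpha_{i_{t+1}}$ are exactly the roots of $H(x)$. Let $U(x),V(x)\in\mathbb F_{q^m}[x]$ be such that $$G(x)=U(x)H(x)+V(x)H'(x)$$ has degree $\deg(G)=t$ and satisfies $G(\alpha_i)\neq 0$ for all $1\le i\le n$, and let $\Gamma(L,G)\subseteq\mathbb F_q^n$ be the $q$-ary Goppa code with support $L$ and Goppa polynomial $G$. Then $\Gamma(L,G)$ contains a codeword $\mathbf c\in\mathbb F_q^n$ with $\operatorname{supp}(\mathbf c)=\{i_1,\ldots,i_{t+1}\}$ if and only if $$\frac{V(\alpha_{i_{t+1}})}{V(\alpha_{i_j})}\in\mathbb F_q^*\qquad\text{for all }1\le j\le t.$$ Consequently, if this condition holds, then the minimum distance satisfies $d(\Gamma(L,G))=t+1$.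
   Context: $\mathbb F_q^*=\mathbb F_q\setminus\{0\}$ and $H'(x)$ is the formal derivative of $H(x)$. Given a set $L=\{\alpha_1,\ldots,\alpha_n\}\subseteq\mathbb F_{q^m}$ of $n$ distinct elements and a polynomial $G(x)\in\mathbb F_{q^m}[x]$ of degree $t\le n$ with $G(\alpha_i)\ne0$ for all $i$, the $q$-ary Goppa code with support $L$ and Goppa polynomial $G$ is $$\Gamma(L,G)=\Bigl\{(c_1,\ldots,c_n)\in\mathbb F_q^n\ \Big|\ \sum_{i=1}^n\frac{c_i}{x-\alpha_i}\equiv0\pmod{G(x)}\Bigr\},$$ where $\frac1{x-\alpha_i}$ denotes the inverse of $x-\alpha_i$ modulo $G(x)$ (it exists since $G(\alpha_i)\neq0$). For a vector $\mathbf c=(c_1,\ldots,c_n)$, $\operatorname{supp}(\mathbf c)=\{i:c_i\ne0\}$ and $\operatorname{wt}(\mathbf c)=|\operatorname{supp}(\mathbf c)|$; the minimum distance $d(\mathcal C)$ of a linear code $\mathcal C$ is the minimum of $\operatorname{wt}(\mathbf c)$ over nonzero $\mathbf c\in\mathcal C$. Under the hypotheses of the claim, $H'$ does not vanish at the roots of $H$, and $V(\alpha_{i_j})\ne0$ for all $1\le j\le t+1$, so the quotients are well defined. *)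

(* Defs.v *)
From mathcomp Require Import all_boot all_algebra all_field.
Set Implicit Arguments.
Unset Strict Implicit.
Unset Printing Implicit Defensive.
Import GRing.Theory.
Local Open Scope ring_scope.

(* Inverse of p modulo G, for p coprime to G (see invmodpP): with Bezout
   coefficients e, the combination e.1 * p + e.2 * G is only associate to the
   gcd, i.e. a nonzero constant, so it has to be normalised. *)
Definition invmodp (K : fieldType) (G p : {poly K}) : {poly K} :=
  let e := egcdp p G in ((e.1 * p + e.2 * G)`_0)^-1 *: e.1.

Lemma invmodpP (K : fieldType) (G p : {poly K}) :
  coprimep p G -> (invmodp G p * p) %% G = 1 %% G.
Proof.
rewrite /invmodp => /eqP copG; set e := egcdp p G; set d := _ + _.
have /eqp_size sz_d : d %= gcdp p G by rewrite eqp_sym; apply: egcdpE.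
have /size_poly1P[a a0 da] : size d == 1 by rewrite sz_d copG.
have -> : ((d`_0)^-1 *: e.1) * p = 1 - ((d`_0)^-1 *: e.2) * G.
  apply/eqP; rewrite eq_sym subr_eq -!scalerAl -scalerDr -/d da coefC /=.
  by rewrite -mul_polyC -polyCM mulVf.
by rewrite modpD modpN modp_mull oppr0 addr0.
Qed.

(* The c_i lie in F and are embedded in the extension K by scaling. *)
Definition goppa_code (F : finFieldType) (K : fieldExtType F) (n : nat)
    (alpha : 'I_n -> K) (G : {poly K}) : {set 'rV[F]_n} :=
  [set c : 'rV[F]_n |
    (\sum_(i < n) (c 0 i)%:A *: invmodp G ('X - (alpha i)%:P)) %% G == 0].

Definition supp (F : nzRingType) (n : nat) (c : 'rV[F]_n) : {set 'I_n} :=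
  [set i | c 0 i != 0].

Definition wt (F : nzRingType) (n : nat) (c : 'rV[F]_n) : nat := #|supp c|.

(* A relation rather than a function, as the zero code has no minimum
   distance. *)
Definition is_min_dist (F : finFieldType) (n : nat) (C : {set 'rV[F]_n})
    (d : nat) : Prop :=
  (exists c, [/\ c \in C, c != 0 & wt c = d]) /\
  (forall c, c \in C -> c != 0 -> (d <= wt c)%N).

(* The image in the extension K of the nonzero elements of F. *)
Definition in_base_units (F : fieldType) (K : fieldExtType F) (x : K) : Prop :=
  exists2 a : F, a != 0 & x = a%:A.

(* Main.v *)
Require Import Defs.
From mathcomp Require Import all_boot all_algebra all_field.
Set Implicit Arguments.
Unset Strict Implicit.
Unset Printing Implicit Defensive.
Import GRing.Theory.
Local Open Scope ring_scope.

(** Multiplying the sum of the [c_i / (x - alpha_i)], [i] in a set [S]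
    containing the support of [c], by the unit [prod_(i in S) (x - alpha_i)]
    modulo [G] turns the parity check into divisibility by [G] of a polynomial
    [N] of degree less than [#|S|], with
    [N(alpha_i) = c_i * prod_(k in S, k != i) (alpha_i - alpha_k)].
    Taking [S = supp c], these values are nonzero, so [t < wt c].  Taking for
    [S] the indices of the roots of [H], the product is [H] and
    [N(alpha_i) = c_i * H'(alpha_i)], while
    [G(alpha_i) = V(alpha_i) * H'(alpha_i)]; as [deg N <= t], the divisibility
    says that [N] is a scalar multiple of [G], that is, that [c] is
    proportional to the vector of the [V(alpha_i)]. *)

Section Evaluator.

Variables (K : fieldType) (I : finType) (alpha : I -> K).
Implicit Types (S : {set I}) (a : I -> K) (G : {poly K}).

Definition locator S : {poly K} := \prod_(i in S) ('X - (alpha i)%:P).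

(** The polynomial [N] described above: the numerator of the sum of the fractions
    [a i / (x - alpha i)] over the common denominator [locator S]. *)
Definition evaluator a S : {poly K} :=
  \sum_(i in S) a i *: locator (S :\ i).

Lemma locatorD1 S i :
  i \in S -> locator S = ('X - (alpha i)%:P) * locator (S :\ i).
Proof. exact: big_setD1. Qed.

Lemma size_locator S : size (locator S) = #|S|.+1.
Proof. by rewrite /locator -big_enum size_prod_XsubC -cardE. Qed.

Lemma monic_locator S : locator S \is monic.
Proof. exact: monic_prod_XsubC. Qed.

Lemma size_evaluator a S : (size (evaluator a S) <= #|S|)%N.
Proof.
apply: leq_trans (size_sum _ _ _) _; apply/bigmax_leqP => i iS.
rewrite (leq_trans (size_scale_leq _ _))// size_locator.
by rewrite [leqRHS](cardsD1 i) iS.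
Qed.

Lemma root_locator S i : i \in S -> root (locator S) (alpha i).
Proof. by move=> iS; rewrite (locatorD1 iS) rootM root_XsubC eqxx. Qed.

(** As in Lagrange interpolation, every other summand keeps the factor vanishing at [alpha i]. *)
Lemma horner_evaluator a S i : i \in S ->
  (evaluator a S).[alpha i] = a i * (locator (S :\ i)).[alpha i].
Proof.
move=> iS; rewrite horner_sum (bigD1 i)//= hornerZ big1 ?addr0// => k.
case/andP=> _ ki; rewrite hornerZ.
have /rootP -> : root (locator (S :\ k)) (alpha i); last by rewrite mulr0.
by apply: root_locator; rewrite !inE eq_sym ki.
Qed.

Lemma horner_deriv_locator S i : i \in S ->
  (locator S)^`().[alpha i] = (locator (S :\ i)).[alpha i].
Proof.
move=> iS; rewrite (locatorD1 iS) derivM derivXsubC mul1r hornerD hornerM.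
by rewrite hornerXsubC subrr mul0r addr0.
Qed.

Lemma horner_locatorD1_neq0 S i :
  injective alpha -> (locator (S :\ i)).[alpha i] != 0.
Proof.
move=> alpha_inj; rewrite horner_prod prodf_seq_neq0; apply/allP=> k _.
apply/implyP; rewrite !inE hornerXsubC subr_eq0 => /andP[ki _].
by rewrite (inj_eq alpha_inj) eq_sym.
Qed.

(** The difference [p - q] would otherwise have at least as many distinct roots as its size. *)
Lemma poly_eq_in (p q : {poly K}) S : injective alpha ->
    (size p <= #|S|)%N -> (size q <= #|S|)%N ->
  (forall i, i \in S -> p.[alpha i] = q.[alpha i]) -> p = q.
Proof.
move=> alpha_inj szp szq pq; apply/eqP; rewrite -subr_eq0; apply/eqP.
apply: (@roots_geq_poly_eq0 _ _ [seq alpha i | i <- enum S]).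
- apply/allP=> _ /mapP[i + ->]; rewrite mem_enum => iS.
  by rewrite /root hornerD hornerN pq// subrr.
- by rewrite map_inj_uniq ?enum_uniq.
- rewrite size_map -cardE (leq_trans (size_polyD _ _))// size_polyN geq_max.
  by rewrite szp.
Qed.

Lemma coprimep_locator G S :
  (forall i, G.[alpha i] != 0) -> coprimep G (locator S).
Proof.
move=> G0; rewrite /locator; elim/big_rec: _ => [|i p _ cop].
  exact: coprimep1.
by rewrite coprimepMr cop andbT coprimep_XsubC /root G0.
Qed.

(** Since [locator S] is coprime to [G], multiplying by it does not affect divisibility by [G]; the
    product is then congruent to the evaluator term by term. *)
Lemma dvdp_sum_invmodp a G S : (forall i, G.[alpha i] != 0) ->
  (G %| \sum_(i in S) a i *: invmodp G ('X - (alpha i)%:P))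
    = (G %| evaluator a S).
Proof.
move=> G0; rewrite -(Gauss_dvdpr _ (coprimep_locator S G0)).
rewrite -[X in G %| X](subrK (evaluator a S)) dvdp_addr// mulr_sumr -sumrB.
elim/big_rec: _ => [|i p iS Gp]; first exact: dvdp0.
rewrite dvdp_add// (locatorD1 iS).
set q := 'X - _; set l := locator _; set v := invmodp _ _.
have -> : q * l * (a i *: v) - a i *: l = (a i *: l) * (v * q - 1).
  by rewrite mulrBr mulr1 -scalerAr -scalerAl (mulrC q) -mulrA (mulrC q).
apply/dvdp_mull/modp_eq0P.
by rewrite modpD modpN invmodpP ?subrr// coprimep_sym coprimep_XsubC /root G0.
Qed.

End Evaluator.

Section Goppa.

Variables (F : finFieldType) (K : fieldExtType F) (n : nat).
Variables (alpha : 'I_n -> K) (G : {poly K}).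
Hypothesis G0 : forall i, G.[alpha i] != 0.
Implicit Types (c : 'rV[F]_n) (S : {set 'I_n}).

Lemma mem_goppa c S : supp c \subset S ->
  (c \in goppa_code alpha G) = (G %| evaluator alpha (fun i => (c 0 i)%:A) S).
Proof.
move=> /subsetP cS; rewrite inE -dvdp_sum_invmodp//.
rewrite (bigID [in S])/= [X in _ + X]big1 ?addr0; last first.
  move=> i; apply: contraNeq => ci; apply: cS; rewrite inE.
  by apply: contra_neq ci => ->; rewrite !scale0r.
by apply/eqP/idP => /modp_eq0P.
Qed.

Hypothesis alpha_inj : injective alpha.

(** The evaluator has size at most that of [G], so [G] divides it only if it is a scalar multiple
    [l *: G]; this equality can be tested at the [#|S|] points [alpha i]. *)
Lemma mem_goppa_size c S : size G = #|S| -> supp c \subset S ->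
  (c \in goppa_code alpha G) <->
  exists l, forall i, i \in S ->
    (c 0 i)%:A * (locator alpha S)^`().[alpha i] = l * G.[alpha i].
Proof.
move=> szG cS; rewrite (mem_goppa cS).
set e := evaluator _ _ _; split=> [Gdvd|[l lP]].
  have [l e_l] : exists l, e = l *: G.
    have [->|e0] := eqVneq e 0.
      by exists 0; rewrite scale0r.
    have : G %= e.
      rewrite -dvdp_size_eqp// eqn_leq dvdp_leq// szG.
      exact: size_evaluator.
    by rewrite eqp_sym => /eqpf_eq[l _ ->]; exists l.
  exists l => i iS.
  rewrite horner_deriv_locator//.
  by rewrite -(horner_evaluator alpha (fun i => (c 0 i)%:A))// -/e e_l hornerZ.
suff -> : e = l *: G by rewrite -mul_polyC dvdp_mull.
apply: (@poly_eq_in _ _ alpha _ _ S) => //; first exact: size_evaluator.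
  by rewrite -szG; apply: size_scale_leq.
move=> i iS; rewrite horner_evaluator//= -horner_deriv_locator// lP//.
by rewrite hornerZ.
Qed.

(** The evaluator over [supp c] is a multiple of [G] of size at most [wt c], and it is nonzero
    because its values on the support are. *)
Lemma size_le_wt_goppa c :
  c \in goppa_code alpha G -> c != 0 -> (size G <= wt c)%N.
Proof.
rewrite (mem_goppa (subxx _)) => Gdvd c0.
apply: leq_trans (size_evaluator alpha _ _); apply: dvdp_leq Gdvd.
have [i ci] : exists i, i \in supp c.
  apply/set0Pn; apply: contraNneq c0 => s0; apply/eqP/rowP=> i; rewrite mxE.
  by apply/eqP; move/setP/(_ i): s0; rewrite !inE => /negbFE.
apply: contraTneq (ci) => e0.
have := horner_evaluator alpha (fun i => (c 0 i)%:A) ci.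
rewrite e0 horner0 => /esym/eqP; rewrite mulf_eq0.
rewrite (negPf (horner_locatorD1_neq0 _ _ alpha_inj)) orbF.
by rewrite scaler_eq0 oner_eq0 orbF inE negbK.
Qed.

End Goppa.

Theorem mainTheorem1 (F : finFieldType) (K : fieldExtType F) (m t n : nat)
    (hm : (1 <= m)%N) (hK : \dim {:K} = m) (htm : (t.+1 %| m)%N)
    (H : {poly F}) (Hmonic : H \is monic) (Hirr : irreducible_poly H)
    (Hdeg : size H = t.+2)
    (alpha : 'I_n -> K) (alpha_inj : injective alpha)
    (alpha_roots : forall x : K,
       root (map_poly (in_alg K) H) x -> exists i : 'I_n, x = alpha i)
    (idx : 'I_t.+1 -> 'I_n) (idx_inj : injective idx)
    (idx_roots : forall x : K,
       root (map_poly (in_alg K) H) x <-> exists j : 'I_t.+1, x = alpha (idx j))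
    (U V G : {poly K})
    (hG : G = U * map_poly (in_alg K) H + V * (map_poly (in_alg K) H)^`())
    (Gdeg : size G = t.+1) (Galpha : forall i : 'I_n, G.[alpha i] != 0) :
  ((exists2 c : 'rV[F]_n, c \in goppa_code alpha G &
      supp c = [set idx j | j : 'I_t.+1])
   <-> (forall j : 'I_t,
          in_base_units (V.[alpha (idx ord_max)]
                         / V.[alpha (idx (widen_ord (leqnSn t) j))])))
  /\ ((forall j : 'I_t,
          in_base_units (V.[alpha (idx ord_max)]
                         / V.[alpha (idx (widen_ord (leqnSn t) j))]))
      -> is_min_dist (goppa_code alpha G) t.+1).
Proof.
set S := [set idx j | j : 'I_t.+1]; set B := (forall j, _).
set h := map_poly (in_alg K) H in alpha_roots idx_roots hG *.
have cardS : #|S| = t.+1 by rewrite card_imset// card_ord.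
have idxS j : idx j \in S by apply: imset_f.
(* Both are monic of size [t.+2], and the locator divides [h] because the [alpha i] with [i] in [S]
   are distinct roots of [h]. *)
have h_loc : h = locator alpha S.
  apply/eqP; rewrite -eqp_monic ?monic_locator ?monic_map// eqp_sym.
  rewrite -dvdp_size_eqp ?size_locator ?cardS ?size_map_poly ?Hdeg//.
  rewrite /locator -big_enum -(big_map alpha predT (fun x => 'X - x%:P)).
  apply: uniq_roots_dvdp; last first.
    by rewrite uniq_rootsE map_inj_uniq ?enum_uniq.
  apply/allP=> _ /mapP[i + ->]; rewrite mem_enum => /imsetP[j _ ->].
  by apply/idx_roots; exists j.
have G_V i : i \in S -> G.[alpha i] = V.[alpha i] * h^`().[alpha i].
  move=> iS; rewrite hG hornerD !hornerM h_loc.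
  by rewrite (rootP (root_locator alpha iS)) mulr0 add0r.
have V0 i : i \in S -> V.[alpha i] != 0.
  by move=> /G_V Gi; apply: contraNneq (Galpha i) => V0; rewrite Gi V0 mul0r.
have h'0 i : i \in S -> h^`().[alpha i] != 0.
  by move=> /G_V Gi; apply: contraNneq (Galpha i) => h0; rewrite Gi h0 mulr0.
(* Here [G] takes the value [V * h'] at each root, and the nonzero value of [h'] cancels. *)
have memG c : supp c = S -> (c \in goppa_code alpha G) <->
    exists l, forall i, i \in S -> (c 0 i)%:A = l * V.[alpha i].
  move=> cS; have szG : size G = #|S| by rewrite Gdeg.
  have := mem_goppa_size Galpha alpha_inj szG; rewrite -h_loc => /(_ c) memcS.
  apply: (iff_trans (memcS _)); first by rewrite cS.
  split=> -[l lP]; exists l => i iS.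
    by apply: (mulIf (h'0 i iS)); rewrite lP// G_V// mulrA.
  by rewrite G_V// lP// mulrA.
have iffB : (exists2 c : 'rV[F]_n, c \in goppa_code alpha G & supp c = S) <-> B.
  split=> [[c cG cS] j|BV].
    have c0 i : i \in S -> c 0 i != 0 by rewrite -cS inE.
    have [l lP] := (memG c cS).1 cG.
    set i := idx (widen_ord _ j); set k := idx ord_max.
    have l0 : l != 0.
      apply: contraNneq (c0 k (idxS _)) => l0.
      by move/eqP: (lP k (idxS _)); rewrite l0 mul0r scaler_eq0 oner_eq0 orbF.
    (* The common factor [l] drops out of the quotient of two coordinates. *)
    exists (c 0 k / c 0 i); first by rewrite mulf_neq0 ?invr_eq0 ?c0 ?idxS.
    rewrite [RHS](fmorph_div (in_alg K)) /= !lP ?idxS//.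
    by rewrite -mulf_div divff// mul1r.
  (* The codeword is the vector of values of [V], normalised to be 1 at the last root; its entries
     are the inverses of the quotients in [B]. *)
  have [a aP] : exists a : 'I_n -> F, forall i, i \in S ->
      a i != 0 /\ (a i)%:A = V.[alpha i] / V.[alpha (idx ord_max)].
    have aE i : exists b : F, (i \in S) ==> (b != 0) &&
        (b%:A == V.[alpha i] / V.[alpha (idx ord_max)]).
      have [/imsetP[j _ ->]|] := boolP (i \in S); last by exists 0.
      (* The condition [B] covers the indices below [t]; the remaining one is [ord_max], where the
         quotient is 1. *)
      have [jt|tj] := ltnP j t.
        have [b b0 bE] := BV (Ordinal jt).
        exists b^-1; rewrite invr_eq0 b0 [_%:A](fmorphV (in_alg K)) /=.
        rewrite -bE invf_div.
        by rewrite (_ : widen_ord _ _ = j)//; apply: val_inj.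
      have -> : j = ord_max.
        by apply: val_inj; apply/eqP; rewrite eqn_leq tj -ltnS ltn_ord.
      by exists 1; rewrite oner_eq0 scale1r divff ?V0 ?eqxx ?implybT.
    exists (fun i => xchoose (aE i)) => i iS.
    by have /implyP/(_ iS)/andP[? /eqP] := xchooseP (aE i).
  have cS : supp (\row_i (if i \in S then a i else 0)) = S.
    apply/setP=> i; rewrite !inE mxE; case: ifP => [/aP[]//|].
    by rewrite eqxx.
  exists (\row_i (if i \in S then a i else 0)); last exact: cS.
  apply/(memG _ cS); exists V.[alpha (idx ord_max)]^-1 => i iS.
  by rewrite mxE iS (aP i iS).2 mulrC.
(* The codeword with support [S] attains weight [t.+1], which equals [size G], the general lower
   bound. *)
split=> // /iffB[c cG cS]; split=> [|c' c'G c'0].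
  exists c; split=> //; last by rewrite /wt cS.
  apply: contra_eq_neq cS => ->; apply/eqP=> /setP/(_ (idx ord_max)).
  by rewrite inE mxE eqxx idxS.
by rewrite -Gdeg (size_le_wt_goppa Galpha alpha_inj).
Qed.
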